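(* Let $d\in\mathbb{N}$ and $\tilde\lambda>0$. Let $\tilde N=\{\tilde N(t):t\ge0\}$ be a homogeneous Poisson process with intensity $\tilde\lambda$, and let $\overrightarrow{\tilde U}_i=(\tilde U_{i1},\dots,\tilde U_{id})$, $i=1,2,\dots$, be i.i.d. random vectors with non-negative integer-valued coordinates, independent of $\tilde N$, with $p_0=\mathbb{P}(\overrightarrow{\tilde U}_1=(0,\dots,0))$, $0\le p_0<1$. Let $\overrightarrow U_i=(U_{i1},\dots,U_{id})$, $i=1,2,\dots$, be i.i.d. random vectors distributed as $\overrightarrow{\tilde U}_1$ conditioned on $\overrightarrow{\tilde U}_1\neq(0,\dots,0)$, and let $N=\{N(t):t\ge0\}$ be a homogeneous Poisson process with intensity $\lambda=\tilde\lambda(1-p_0)$, independent of $\overrightarrow U_1,\overrightarrow U_2,\dots$. Define the vector-valued processes $\overrightarrow{\tilde N}_c=\{(\tilde N_{c,1}(t),\dots,\tilde N_{c,d}(t)):t\ge0\}$ and $\overrightarrow N_c=\{(N_{c,1}(t),\dots,N_{c,d}(t)):t\ge0\}$ by $$\tilde N_{c,s}(t)=I\{\tilde N(t)>0\}\sum_{i=1}^{\tilde N(t)}\tilde U_{is},\qquad N_{c,s}(t)=I\{N(t)>0\}\sum_{i=1}^{N(t)}U_{is},\qquad s=1,\dots,d.$$ Then $\overrightarrow{\tilde N}_c$ and $\overrightarrow N_c$ have the same finite-dimensional distributions.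
   Context: $I\{\cdot\}$ is the indicator function; a sum multiplied by an indicator that equals $0$ is read as $0$. Here $\tilde N(t)$ counts groups of claims (including possibly empty ones) up to time $t$, $\tilde U_{is}$ is the number of claims of type $s$ in the $i$-th group, and $N$ counts only the non-empty groups. *)

(* Defs.v *)
From mathcomp Require Export all_boot all_order all_algebra.
From mathcomp Require Export all_classical all_reals all_analysis.

Set Implicit Arguments.
Unset Strict Implicit.
Unset Printing Implicit Defensive.

Export Order.TTheory GRing.Theory Num.Theory.
Export numFieldNormedType.Exports.

#[global] Open Scope classical_set_scope.
#[global] Open Scope ring_scope.

(* A process {X(t) : t >= 0} is a family indexed by {nonneg R}; a sequence
   X_1, X_2, ... is indexed from 0, i.e. X_i is [X i.-1]. *)

Definition mutually_independent d d' (T : measurableType d)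
    (T' : measurableType d') (R : realType) (P : probability T R)
    (I : eqType) (X : I -> T -> T') : Prop :=
  forall (J : seq I) (B : I -> set T'), uniq J ->
    (forall i, measurable (B i)) ->
    P (\bigcap_(i in [set` J]) (X i @^-1` B i)) =
    (\prod_(i <- J) P (X i @^-1` B i))%E.

Definition iid d d' (T : measurableType d) (T' : measurableType d')
    (R : realType) (P : probability T R) (X : nat -> {RV P >-> T'}) : Prop :=
  mutually_independent P (fun i => X i : T -> T') /\
  forall i j (B : set T'), measurable B ->
    distribution P (X i) B = distribution P (X j) B.
Arguments iid {d d' T T' R} P X.

Definition sigma_of_family d d' (T : measurableType d)
    (T' : measurableType d') (I : Type) (X : I -> T -> T') : set (set T) :=
  <<s \bigcup_i preimage_set_system setT (X i) measurable >>.

(* Independence of two families as wholes, not merely of their members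
   pairwise. *)
Definition independent_families d d1 d2 (T : measurableType d)
    (T1 : measurableType d1) (T2 : measurableType d2) (R : realType)
    (P : probability T R) (I J : Type)
    (X : I -> {RV P >-> T1}) (Y : J -> {RV P >-> T2}) : Prop :=
  forall A B : set T,
    sigma_of_family (fun i => X i : T -> T1) A ->
    sigma_of_family (fun j => Y j : T -> T2) B ->
    P (A `&` B) = (P A * P B)%E.
Arguments independent_families {d d1 d2 T T1 T2 R} P {I J} X Y.

Definition cond_prob d (T : measurableType d) (R : realType)
    (P : probability T R) (A C : set T) : R :=
  fine (P (A `&` C)) / fine (P C).

(* N(0) = 0 and the path is nondecreasing and right-continuous. Since it is
   nat-valued, right-continuity at t means being constant on some [t, u). *)
Definition counting_path (R : realType) (n : {nonneg R} -> nat) : Prop :=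
  [/\ n 0%:nng = 0%N,
      {homo n : s t / s <= t >-> (s <= t)%N} &
      forall t, exists2 u, t < u & forall v, t <= v < u -> n v = n t].

(* The subtraction of nat is truncated, but almost every path is nondecreasing.
   Finite sequences of times are covered by extending them by a constant.
   [poisson_pmf] is a probability mass function only for a positive rate, so
   lambda is meant to be positive and s < t is required. *)
Definition poisson_process d (T : measurableType d) (R : realType)
    (P : probability T R) (lambda : R) (N : {nonneg R} -> {RV P >-> nat})
    : Prop :=
  [/\ {ae P, forall w, counting_path (fun t => N t w)},
      forall t : nat -> {nonneg R}, {homo t : i j / (i <= j)%N >-> i <= j} ->
        mutually_independent P (fun i w => (N (t i.+1) w - N (t i) w)%N) &
      forall (s t : {nonneg R}) (k : nat), s < t ->
        P [set w | (N t w - N s w)%N = k] =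
        (poisson_pmf (lambda * (t%:num - s%:num)) k)%:E].
Arguments poisson_process {d T R} P lambda N.

Definition compound d (T : measurableType d) (R : realType) (m : nat)
    (P : probability T R)
    (N : {nonneg R} -> {RV P >-> nat}) (U : nat -> {RV P >-> m.-tuple nat})
    (t : {nonneg R}) (w : T) : m.-tuple nat :=
  [tuple ((0 < N t w) * \sum_(i < N t w) tnth (U i w) s)%N | s < m].

(* The two processes may live on different probability spaces. *)
Definition same_fdd d1 d2 d' (T1 : measurableType d1) (T2 : measurableType d2)
    (T' : measurableType d') (R : realType)
    (P1 : probability T1 R) (P2 : probability T2 R) (I : Type)
    (X : I -> T1 -> T') (Y : I -> T2 -> T') : Prop :=
  forall (n : nat) (t : 'I_n -> I) (B : set (n.-tuple T')), measurable B ->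
    P1 [set w | B [tuple X (t j) w | j < n]] =
    P2 [set w | B [tuple Y (t j) w | j < n]].

(* Main.v *)
Require Import Defs.
From mathcomp Require Import ring.

(** The partial sums of the claim vectors form a Markov chain on a countable
    set with kernel [K x y = P(x + U_1 = y)]. Conditioning on the independent
    Poisson increments over sorted times, the compound process has transition
    probabilities [sum_a Poisson(lambda * dt; a) * K^a]. Allowing empty claim
    groups replaces [K] by the lazy kernel [p0 * Id + (1 - p0) * K], whose
    powers expand binomially in those of [K]; binomial thinning of a Poisson
    variable with mean [L] gives mean [L * (1 - p0)], so the transition
    probabilities of the two compound processes coincide. *)

Set Implicit Arguments.
Unset Strict Implicit.
Unset Printing Implicit Defensive.

Local Open Scope ereal_scope.

(** * Sums of non-negative families in the extended reals *)

(** For finite [x], scaling commutes with the supremum over finite partial sums. For [x = +oo], both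
    sides are 0 if [f] vanishes identically and [+oo] otherwise. *)
Lemma ge0_esumZl (R : realType) (I : choiceType) (x : \bar R)
    (f : I -> \bar R) : 0 <= x -> (forall i, 0 <= f i) ->
  \esum_(i in setT) (x * f i) = x * \esum_(i in setT) f i.
Proof.
move=> x0 f0; case: x x0 => [r| |//]; rewrite ?lee_fin => x0.
  rewrite /esum -ereal_supZl//; last first.
    by apply/set0P; exists 0, set0; [exact: fsets_set0|rewrite fsbig_set0].
  rewrite image_comp; congr ereal_sup; apply: eq_imagel => A _ /=.
  by rewrite ge0_mule_fsumr.
have [f00|/existsNP[i fi0]] := pselect (forall i, f i = 0).
  by rewrite !esum1 ?mule0// => i _; rewrite f00 mule0.
have fi : 0 < f i by rewrite lt0e f0 andbT; exact/eqP.
have h (g : I -> \bar R) : g i <= \esum_(j in setT) g j.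
  by apply: esum_ge; exists [set i]; rewrite ?fsbig_set1.
rewrite gt0_mulye; last exact: lt_le_trans (h _).
apply/eqP; rewrite -leye_eq -[leLHS](gt0_mulye fi).
exact: (h (fun j => +oo * f j)).
Qed.

Lemma esum_single (R : realType) (I : choiceType) (i : I) (f : I -> \bar R) :
  (forall j, j != i -> f j = 0) -> 0 <= f i -> \esum_(j in setT) f j = f i.
Proof.
move=> fN0 fi0; rewrite -(esum_set1 fi0) [RHS]esum_mkcond;
  apply: eq_esum => j _.
by case: ifPn => //; rewrite notin_setE/= => /eqP/fN0.
Qed.

(** Both iterated sums equal the sum over the product set, up to swapping the coordinates. *)
Lemma exchange_esum (R : realType) (I J : choiceType) (f : I -> J -> \bar R) :
  (forall i j, 0 <= f i j) ->
  \esum_(i in setT) \esum_(j in setT) f i j =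
  \esum_(j in setT) \esum_(i in setT) f i j.
Proof.
move=> f0; rewrite !esum_esum// (_ : _ `*`` _ = setT); last exact/seteqP.
rewrite (_ : _ `*`` _ = setT); last exact/seteqP.
rewrite (reindex_esum setT _ (fun x : J * I => (x.2, x.1))) //.
by split => // [[x y] [z t] _ _ [-> ->]//|[x y] _]; exists (y, x).
Qed.

(** Every list is either empty or uniquely a [c :: s]; this lets sums over vectors of increments be
    treated one increment at a time. *)
Lemma esum_seq (R : realType) (C : countType) (f : seq C -> \bar R) :
  (forall s, 0 <= f s) ->
  \esum_(s in setT) f s =
  f [::] + \esum_(c in setT) \esum_(s in setT) f (c :: s).
Proof.
move=> f0; rewrite (esumID [set [::]])//; congr +%E.
  by rewrite setTI esum_set1.
rewrite (esum_esum (a := fun c s => f (c :: s)))//.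
rewrite (_ : _ `*`` _ = setT); last exact/seteqP.
rewrite (reindex_esum setT _ (fun x : C * seq C => x.1 :: x.2))//.
split.
- by move=> [c s] _.
- by move=> [c s] [c' s'] _ _ /= [-> ->].
- by move=> [[_ []//]|c s _]; exists (c, s).
Qed.

(** * Random variables with countably many values *)

(** Only the fibres are mentioned, so [C] carries no sigma-algebra and the one on [T] can be
    replaced by a coarser one. *)
Definition discrete_rv d (T : measurableType d) (C : Type) (X : T -> C) :=
  forall c, measurable (X @^-1` [set c]).

Section discrete_rv.
Context d (T : measurableType d).

Lemma discrete_rv_preimage (C : countType) (X : T -> C) (B : set C) :
  discrete_rv X -> measurable (X @^-1` B).
Proof.
move=> mX.
rewrite (_ : _ @^-1` _ =
  \bigcup_c (if c \in B then X @^-1` [set c] else set0)); last first.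
  apply/seteqP; split => [w /= Bw|w [c _]].
    by exists (X w) => //=; rewrite mem_set.
  by case: ifPn => //; rewrite inE /= => Bc ->.
apply: countable_bigcupT_measurable => // c.
by case: ifP.
Qed.

Lemma discrete_rv_comp (C C' : countType) (X : T -> C) (f : C -> C') :
  discrete_rv X -> discrete_rv (f \o X).
Proof. by move=> mX c; rewrite comp_preimage; exact: discrete_rv_preimage. Qed.

Lemma discrete_rv_pair (C C' : Type) (X : T -> C) (Y : T -> C') :
  discrete_rv X -> discrete_rv Y -> discrete_rv (fun w => (X w, Y w)).
Proof.
move=> mX mY [c c'].
rewrite (_ : _ @^-1` _ = X @^-1` [set c] `&` Y @^-1` [set c']).
  exact: measurableI.
by apply/seteqP; split => w /= [-> ->].
Qed.

Lemma discrete_rv_comp2 (C C' C'' : countType) (X : T -> C) (Y : T -> C')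
    (f : C -> C' -> C'') : discrete_rv X -> discrete_rv Y ->
  discrete_rv (fun w => f (X w) (Y w)).
Proof.
move=> mX mY; have mXY := discrete_rv_pair mX mY.
exact: (discrete_rv_comp (fun xy => f xy.1 xy.2) mXY).
Qed.

Lemma discrete_rv_cst (C : Type) (c : C) : discrete_rv (fun _ : T => c).
Proof.
move=> c'; have [->|cc'] := pselect (c = c').
  by rewrite (_ : _ @^-1` _ = setT)//; apply/seteqP; split.
by rewrite (_ : _ @^-1` _ = set0)//; apply/seteqP; split.
Qed.

Lemma discrete_rv_map (I : Type) (C : countType) (X : I -> T -> C) (s : seq I) :
  (forall i, discrete_rv (X i)) -> discrete_rv (fun w => [seq X i w | i <- s]).
Proof.
move=> mX; elim: s => [|i s IHs] /=; first exact: discrete_rv_cst.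
exact: (discrete_rv_comp2 cons (mX i) IHs).
Qed.

Lemma discrete_rv_pairmap (I : Type) (C : countType) (X : I -> I -> T -> C)
    (i : I) (s : seq I) : (forall i j, discrete_rv (X i j)) ->
  discrete_rv (fun w => pairmap (fun i j => X i j w) i s).
Proof.
move=> mX; elim: s i => [|j s IHs] i /=; first exact: discrete_rv_cst.
exact: (discrete_rv_comp2 cons (mX i j) (IHs j)).
Qed.

(** Splitting over the countably many values of the index [X] reduces the claim to fixed indices. It
    serves for a walk evaluated at a random time. *)
Lemma discrete_rv_dep (I C : countType) (X : T -> I) (Y : I -> T -> C) :
  discrete_rv X -> (forall i, discrete_rv (Y i)) ->
  discrete_rv (fun w => Y (X w) w).
Proof.
move=> mX mY c.
rewrite (_ : _ @^-1` _ = \bigcup_i (X @^-1` [set i] `&` Y i @^-1` [set c])).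
  apply: countable_bigcupT_measurable => // i.
  by apply: measurableI; [exact: mX|exact: mY].
apply/seteqP; split => [w /= <-|w [i _ [/= -> //]]].
by exists (X w).
Qed.

(** Countable additivity, with the values of [X] numbered by [pickle]; numbers that code no value
    contribute empty pieces. *)
Lemma total_probability (R : realType) (P : probability T R) (C : countType)
    (X : T -> C) (E : set T) : discrete_rv X -> measurable E ->
  P E = \esum_(c in setT) P (E `&` X @^-1` [set c]).
Proof.
move=> mX mE; pose F n := E `&` [set w | pickle (X w) = n].
have mF n : measurable (F n).
  by apply: measurableI => //;
    exact: (discrete_rv_preimage [set c | pickle c = n] mX).
rewrite [in LHS](_ : E = \bigcup_n F n); last first.
  by apply/seteqP; split => [w Ew|w [n _ []//]]; exists (pickle (X w)).
rewrite measure_semi_bigcup//; last exact: bigcup_measurable.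
  have -> : [set: C] = \bigcup_n [set c | pickle c = n].
    by apply/seteqP; split => // c _; exists (pickle c).
  rewrite nneseries_sum_bigcup//; last first.
    by move=> i j _ _ [c [/= <- <-]].
  apply: eq_eseriesr => n _.
  have [[c cn]|nn] := pselect (exists c : C, pickle c = n).
    rewrite (_ : [set c | _] = [set c]).
      rewrite esum_set1//; congr (P _); apply/seteqP; split => w /=.
        move=> [Ew wn]; split=> //.
        by apply: (pcan_inj (@pickleK C)); rewrite wn cn.
      by move=> [Ew Xw]; split => //=; rewrite Xw.
    apply/seteqP; split => c' /= => [|->//].
    by rewrite -cn => /(pcan_inj (@pickleK C)).
  rewrite (_ : [set c | _] = set0).
    rewrite esum_set0 (_ : F n = set0) ?measure0//.
    by apply/seteqP; split => // w [_ /= wn]; apply: nn; exists (X w).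
  by apply/seteqP; split => // c /= cn; apply: nn; exists c.
by move=> i j _ _ [w [[_ /= <-] [_ /= <-]]].
Qed.

End discrete_rv.

(** * Poisson and binomial weights, and Poisson thinning *)

Lemma esum_nat_recl (R : realType) (f : nat -> \bar R) :
  (forall n, 0 <= f n) ->
  \esum_(n in setT) f n = f 0%N + \esum_(n in setT) f n.+1.
Proof.
move=> f0; rewrite (esumID [set 0%N])//; congr +%E.
  by rewrite setTI esum_set1.
rewrite (reindex_esum setT _ S)//; split => //.
- by move=> m n _ _; exact: succn_inj.
- by move=> n [_ /eqP n0]; exists n.-1 => //; rewrite prednK// lt0n.
Qed.

(* Unlike [poisson_pmf], this is also the correct law (a point mass at 0) for
   [L = 0], which occurs when times are repeated. *)
Definition poisson_weight (R : realType) (L : R) (k : nat) : R :=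
  (L ^+ k * k`!%:R^-1 * expR (- L))%R.

(** The probability that [b] of [a] groups are non-empty when each is empty with probability [p].
    For [a < b] the binomial coefficient is 0, so the truncated exponent [a - b] is harmless. *)
Definition binomial_weight (R : realType) (p : R) (a b : nat) : R :=
  ('C(a, b)%:R * p ^+ (a - b) * (1 - p) ^+ b)%R.

Section weights.
Variable R : realType.
Implicit Types L p : R.

Lemma poisson_weight_ge0 L k : (0 <= L)%R -> (0 <= poisson_weight L k)%R.
Proof. by move=> L0; rewrite !mulr_ge0 ?exprn_ge0 ?invr_ge0 ?expR_ge0. Qed.

Lemma poisson_weight0 k : poisson_weight (0 : R) k = (k == 0%N)%:R%R.
Proof.
rewrite /poisson_weight oppr0 expR0 mulr1 expr0n.
by case: k => [|k]; rewrite ?mul0r// fact0 invr1 mulr1.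
Qed.

Lemma poisson_weightE L k : (0 < L)%R -> poisson_weight L k = poisson_pmf L k.
Proof. by move=> L0; rewrite /poisson_pmf L0. Qed.

Lemma esum_poisson_weight L : (0 <= L)%R ->
  \esum_(k in setT) (poisson_weight L k)%:E = 1.
Proof.
rewrite le_eqVlt => /predU1P[<-|L0].
  rewrite (@esum_single _ _ 0%N); first by rewrite poisson_weight0 eqxx.
    by move=> k /negPf k0; rewrite poisson_weight0 k0.
  by rewrite poisson_weight0.
(* The 1 on the right becomes the total mass of the Poisson probability measure, which unfolds to
   the sum on the left. *)
rewrite -(@probability_setT _ _ _ (poisson_prob L 0)) /poisson_prob L0.
under eq_esum do rewrite poisson_weightE//.
by rewrite /= /poisson_prob L0.
Qed.

Lemma binomial_weight_ge0 p a b :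
  (0 <= p <= 1)%R -> (0 <= binomial_weight p a b)%R.
Proof. by case/andP => p0 p1; rewrite !mulr_ge0 ?exprn_ge0// subr_ge0. Qed.

Lemma binomial_weightS0 p a :
  binomial_weight p a.+1 0 = (p * binomial_weight p a 0)%R.
Proof. by rewrite /binomial_weight !bin0 !subn0 !mul1r !mulr1 exprS. Qed.

(** Pascal's rule: the last group is either empty or not. *)
Lemma binomial_weightSS p a b : binomial_weight p a.+1 b.+1 =
  (p * binomial_weight p a b.+1 + (1 - p) * binomial_weight p a b)%R.
Proof.
rewrite /binomial_weight binS natrD !mulrDl subSS; congr +%R; last first.
  by rewrite exprS; ring.
have [ab|ba] := leqP a b; first by rewrite bin_small// !mul0r mulr0.
by rewrite -[X in (p ^+ X)%R](subnSK ba) exprS; ring.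
Qed.

(** Thinning. The terms with [a < b] vanish; for [a = b + k] the term factors into the Poisson
    weights of [b] with mean [L * (1 - p)] and of [k] with mean [L * p], and the latter sum to 1
    over [k]. *)
Lemma poisson_binomial_weight L p b : (0 <= L)%R -> (0 <= p <= 1)%R ->
  \esum_(a in setT) (poisson_weight L a * binomial_weight p a b)%:E =
  (poisson_weight (L * (1 - p)) b)%:E.
Proof.
move=> L0 /andP[p0 p1].
rewrite (esumID [set a | (b <= a)%N]); last first.
  by move=> a _;
    rewrite lee_fin mulr_ge0 ?poisson_weight_ge0 ?binomial_weight_ge0 ?p0.
rewrite [X in _ + X]esum1 ?adde0; last first.
  move=> a [_ /= /negP]; rewrite -ltnNge => ab.
  by rewrite /binomial_weight bin_small// !mul0r mulr0.
rewrite (reindex_esum setT _ (addn b)); last first.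
  split; first by move=> k _ /=; split => //=; exact: leq_addr.
  - by move=> k l _ _ /addnI.
  - by move=> a [_ /= ba]; exists (a - b)%N => //; rewrite subnKC.
rewrite -[RHS]mule1 -(esum_poisson_weight (mulr_ge0 L0 p0)) -ge0_esumZl.
- apply: eq_esum => k _; rewrite -EFinM; congr EFin.
  rewrite /poisson_weight /binomial_weight addKn.
  have -> : (- L = - (L * (1 - p)) + - (L * p))%R by ring.
  rewrite expRD !exprMn exprD -(@bin_fact (b + k) b) ?leq_addr// addKn !natrM.
  have h n : n`!%:R != 0%R :> R by rewrite pnatr_eq0 -lt0n fact_gt0.
  have hC : 'C(b + k, b)%:R != 0%R :> R.
    by rewrite pnatr_eq0 -lt0n bin_gt0 leq_addr.
  by field; rewrite !h hC.
- by rewrite lee_fin poisson_weight_ge0// mulr_ge0// subr_ge0.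
- by move=> k; rewrite lee_fin poisson_weight_ge0// mulr_ge0.
Qed.

End weights.

(** * Iterates of kernels, lazy kernels and Poisson mixtures *)

Section kernel.
Variables (R : realType) (V : countType).
Implicit Types K : V -> V -> \bar R.

Fixpoint kernel_iter K (a : nat) (x y : V) : \bar R :=
  if a is a'.+1 then \esum_(z in setT) (kernel_iter K a' x z * K z y)
  else (x == y)%:R%:E.

Lemma kernel_iter_ge0 K a x y :
  (forall x y, 0 <= K x y) -> 0 <= kernel_iter K a x y.
Proof.
move=> K0; elim: a y => [|a IHa] y /=; first by rewrite lee_fin.
by apply: esum_ge0 => z _; rewrite mule_ge0.
Qed.

(** Binomial expansion of a power of [p * Id + (1 - p) * K], by induction on [a]: one more lazy step
    either stays, with weight [p], or multiplies by [K], with weight [1 - p]. *)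
Lemma kernel_iter_lazy K K' p a x y : (0 <= p <= 1)%R ->
  (forall x y, 0 <= K x y) ->
  (forall x y, K' x y = p%:E * (x == y)%:R%:E + (1 - p)%:E * K x y) ->
  kernel_iter K' a x y =
  \esum_(b in setT) ((binomial_weight p a b)%:E * kernel_iter K b x y).
Proof.
move=> p01 K0 K'E; have /andP[p0 p1] := p01.
have q0 : (0 <= 1 - p)%R by rewrite subr_ge0.
have pE0 : 0 <= p%:E by rewrite lee_fin.
have qE0 : 0 <= (1 - p)%:E by rewrite lee_fin.
have dE0 (z t : V) : 0 <= (z == t)%:R%:E :> \bar R by rewrite lee_fin.
have w0 a' b : 0 <= (binomial_weight p a' b)%:E.
  by rewrite lee_fin binomial_weight_ge0.
have Ki0 b x' y' : 0 <= kernel_iter K b x' y' by exact: kernel_iter_ge0.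
elim: a y => [|a IHa] y.
  rewrite (@esum_single _ _ 0%N)/=.
  - by rewrite /binomial_weight bin0 subnn !mulr1 mul1e.
  - by move=> b b0; rewrite /binomial_weight bin0n (negPf b0) !mul0r mul0e.
  - by rewrite mule_ge0// lee_fin.
rewrite [LHS]/=.
transitivity (\esum_(b in setT) ((binomial_weight p a b)%:E *
    (p%:E * kernel_iter K b x y + (1 - p)%:E * kernel_iter K b.+1 x y))).
  transitivity (\esum_(z in setT) \esum_(b in setT)
      ((binomial_weight p a b)%:E * (kernel_iter K b x z * K' z y))).
    apply: eq_esum => z _; rewrite IHa muleC -ge0_esumZl.
    - by apply: eq_esum => b _; rewrite muleC muleA.
    - by rewrite K'E adde_ge0// mule_ge0.
    - by move=> b; rewrite mule_ge0.
  have K'0 x' y' : 0 <= K' x' y' by rewrite K'E adde_ge0// mule_ge0.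
  rewrite exchange_esum; last by move=> *; rewrite !mule_ge0.
  apply: eq_esum => b _; rewrite ge0_esumZl//; last first.
    by move=> z; rewrite mule_ge0.
  congr *%E.
  transitivity (\esum_(z in setT) (p%:E * (kernel_iter K b x z * (z ==
    y)%:R%:E) +
      (1 - p)%:E * (kernel_iter K b x z * K z y))).
    apply: eq_esum => z _; rewrite K'E ge0_muleDr ?mule_ge0//.
    by congr +%E; rewrite muleCA.
  rewrite esumD; last 2 first.
  - by move=> z _; rewrite !mule_ge0.
  - by move=> z _; rewrite !mule_ge0.
  rewrite !ge0_esumZl//; last 2 first.
  - by move=> z; rewrite !mule_ge0.
  - by move=> z; rewrite !mule_ge0.
  congr (_ * _ + _).
  rewrite (@esum_single _ _ y) ?eqxx ?mule1//.
  by move=> z /negPf ->; rewrite mule0.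
transitivity (\esum_(b in setT) ((p * binomial_weight p a b)%:E * kernel_iter K
  b x y) +
   \esum_(b in setT) (((1 - p) * binomial_weight p a b)%:E * kernel_iter K b.+1
     x y)).
  rewrite -esumD; last 2 first.
  - by move=> b _; rewrite (EFinM _ (binomial_weight _ _ _)) !mule_ge0.
  - by move=> b _; rewrite (EFinM _ (binomial_weight _ _ _)) !mule_ge0.
  apply: eq_esum => b _; rewrite ge0_muleDr ?mule_ge0//.
  by rewrite (EFinM p) (EFinM (1 - p)) !muleA (muleC _ p%:E) (muleC _ (1 -
    p)%:E).
(* Peeling off index 0 on both sides leaves sums over [kernel_iter K b.+1], which Pascal's rule
   matches term by term. *)
rewrite esum_nat_recl; last by move=> b;
  rewrite (EFinM _ (binomial_weight _ _ _)) !mule_ge0.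
rewrite [RHS]esum_nat_recl; last by move=> b; rewrite mule_ge0.
rewrite binomial_weightS0 -addeA; congr +%E.
rewrite -esumD; last 2 first.
- by move=> b _; rewrite (EFinM _ (binomial_weight _ _ _)) !mule_ge0.
- by move=> b _; rewrite (EFinM _ (binomial_weight _ _ _)) !mule_ge0.
apply: eq_esum => b _; rewrite binomial_weightSS [in RHS]EFinD ge0_muleDl//.
  by rewrite EFinM mule_ge0.
by rewrite EFinM mule_ge0.
Qed.

Definition poisson_mixture K (L : R) (x y : V) : \bar R :=
  \esum_(a in setT) ((poisson_weight L a)%:E * kernel_iter K a x y).

(** After the binomial expansion, exchanging the sums leaves for each [b] a sum over [a] that is
    evaluated by Poisson thinning. *)
Lemma poisson_mixture_lazy K K' p L x y : (0 <= L)%R -> (0 <= p <= 1)%R ->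
  (forall x y, 0 <= K x y) ->
  (forall x y, K' x y = p%:E * (x == y)%:R%:E + (1 - p)%:E * K x y) ->
  poisson_mixture K' L x y = poisson_mixture K (L * (1 - p)) x y.
Proof.
move=> L0 p01 K0 K'E.
have pw0 a : 0 <= (poisson_weight L a)%:E by rewrite lee_fin poisson_weight_ge0.
have w0 a' b : 0 <= (binomial_weight p a' b)%:E.
  by rewrite lee_fin binomial_weight_ge0.
have Ki0 b x' y' : 0 <= kernel_iter K b x' y' by exact: kernel_iter_ge0.
transitivity (\esum_(a in setT) \esum_(b in setT)
    (kernel_iter K b x y * (poisson_weight L a * binomial_weight p a b)%:E)).
  apply: eq_esum => a _;
    rewrite (kernel_iter_lazy a x y p01 K0 K'E) -ge0_esumZl//.
    by apply: eq_esum => b _; rewrite muleA -EFinM muleC.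
  by move=> b; rewrite mule_ge0.
rewrite exchange_esum; last by move=> a b;
  rewrite (EFinM _ (binomial_weight _ _ _)) !mule_ge0.
apply: eq_esum => b _; rewrite ge0_esumZl ?poisson_binomial_weight//.
  by rewrite muleC.
by move=> a; rewrite EFinM mule_ge0.
Qed.

End kernel.

(** * Random walks with i.i.d. steps as Markov chains *)

Section path_weight.
Variables (R : realType) (V : countType) (K : V -> V -> \bar R).

(** The probability that the chain started at [x] shows the successive states [v] when the entries
    of [a] are the numbers of steps between observations; lists of different lengths get weight
    0. *)
Fixpoint path_weight (a : seq nat) (v : seq V) (x : V) : \bar R :=
  match a, v with
  | [::], [::] => 1
  | k :: a', y :: v' => kernel_iter K k x y * path_weight a' v' y
  | _, _ => 0
  end.

Lemma path_weight_ge0 a v x : (forall x y, 0 <= K x y) ->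
  0 <= path_weight a v x.
Proof.
move=> K0; elim: a v x => [|k a IHa] [|y v] x //=.
by rewrite mule_ge0 ?kernel_iter_ge0.
Qed.

End path_weight.

Section walk.
Variables (V : Type) (add : V -> V -> V) (x0 : V).

Fixpoint walk (u : nat -> V) (m : nat) : V :=
  if m is m'.+1 then add (walk u m') (u m') else x0.

Lemma eq_walk u u' m : (forall i, (i < m)%N -> u i = u' i) ->
  walk u m = walk u' m.
Proof.
elim: m => //= m IHm uu'; rewrite IHm ?uu'// => i im.
by rewrite uu'// ltnW.
Qed.

End walk.

Section iid_walk.
Context d (T : measurableType d) (R : realType) (P : probability T R).
Variables (V : countType) (add : V -> V -> V) (x0 : V) (U : nat -> T -> V).
Hypothesis mU : forall i, discrete_rv (U i).
Hypothesis indepU : forall (J : seq nat) (B : nat -> set V), uniq J ->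
  P (\bigcap_(i in [set` J]) (U i @^-1` B i)) =
  \prod_(i <- J) P (U i @^-1` B i).
Hypothesis identU : forall i (B : set V), P (U i @^-1` B) = P (U 0%N @^-1` B).

Local Notation S w m := (walk add x0 (U ^~ w) m).

(** The step with index 0 stands for all steps, as these have the same law. *)
Definition step_kernel (x y : V) : \bar R :=
  P (U 0%N @^-1` [set u | add x u = y]).

(** The events decided by the first [m] steps, described pointwise; since [V] is countable, this
    already implies measurability. *)
Definition past (m : nat) (E : set T) : Prop :=
  forall w w', (forall i, (i < m)%N -> U i w = U i w') -> E w -> E w'.

Lemma pastW m n E : (m <= n)%N -> past m E -> past n E.
Proof. by move=> mn pE w w' h; apply: pE => i im; apply: h;
  exact: leq_trans mn. Qed.

Lemma pastI m E F : past m E -> past m F -> past m (E `&` F).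
Proof. by move=> pE pF w w' h [Ew Fw]; split; [exact: pE Ew|exact: pF Fw]. Qed.

Lemma past_walk m x : past m [set w | S w m = x].
Proof. by move=> w w' h /= <-; apply: eq_walk => i im; rewrite h. Qed.

Lemma measurable_walk m : discrete_rv (fun w => S w m).
Proof.
elim: m => [|m IHm] /=; first exact: discrete_rv_cst.
exact: (discrete_rv_comp2 add IHm (mU m)).
Qed.

Definition history (m : nat) (w : T) : seq V := [seq U i w | i <- iota 0 m].

Lemma measurable_history m : discrete_rv (history m).
Proof. exact: discrete_rv_map. Qed.

(** Two outcomes with the same history are not separated by [E], so [E] is a union of fibres of
    [history m]. *)
Lemma past_history m E : past m E ->
  E = history m @^-1` [set history m w | w in E].
Proof.
move=> pE; apply/seteqP; split => [w Ew|w [w' Ew' ww']]; first by exists w.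
apply: pE Ew' => i im.
by move/eq_in_map : ww'; apply; rewrite mem_iota.
Qed.

Lemma past_measurable m E : past m E -> measurable E.
Proof.
move=> /past_history ->; exact: discrete_rv_preimage (@measurable_history m).
Qed.

Lemma history_indep m v (B : set V) :
  P (history m @^-1` [set v] `&` U m @^-1` B) =
  P (history m @^-1` [set v]) * P (U m @^-1` B).
Proof.
have [szv|szv] := eqVneq (size v) m; last first.
  rewrite (_ : history m @^-1` _ = set0) ?set0I ?measure0 ?mul0e//.
  apply/seteqP; split => // w /= wv; move/eqP : szv; apply.
  by rewrite -wv size_map size_iota.
(* Steps before [m] are pinned to the entries of [v] and step [m] is constrained by [B], so mutual
   independence applies to one finite intersection over the indices up to [m]. *)
pose F i := if i == m then B else [set nth x0 v i].
have iotaS : iota 0 m.+1 = iota 0 m ++ [:: m] by rewrite -addn1 iotaD.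
have histE : history m @^-1` [set v] =
    \bigcap_(i in [set` iota 0 m]) (U i @^-1` F i).
  apply/seteqP; split => [w /= wv i|w /= h].
    rewrite /= mem_iota => /= im; rewrite /F ltn_eqF//= -wv.
    by rewrite (nth_map 0%N) ?size_iota// nth_iota.
  apply: (@eq_from_nth _ x0); rewrite size_map size_iota// => i im.
  rewrite (nth_map 0%N) ?size_iota// nth_iota// add0n.
  by have := h i; rewrite /= mem_iota /F ltn_eqF//= => ->.
have -> : history m @^-1` [set v] `&` U m @^-1` B =
    \bigcap_(i in [set` iota 0 m.+1]) (U i @^-1` F i).
  rewrite histE; apply/seteqP; split => [w [wF wB] i|w wF].
    rewrite iotaS /= mem_cat mem_seq1 => /orP[/wF//|/eqP ->].
    by rewrite /F eqxx.
  split=> [i im|]; first by apply: wF; rewrite iotaS /= mem_cat im.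
  by have := wF m; rewrite /F eqxx; apply;
    rewrite iotaS /= mem_cat mem_seq1 eqxx orbT.
rewrite histE !indepU ?iota_uniq// iotaS big_cat/= big_seq1; congr (_ * P _).
by rewrite /F eqxx.
Qed.

(** Each fibre of [history m] lies inside [E] or is disjoint from it; summing over the fibres
    reduces the claim to [history_indep]. *)
Lemma past_indep m E (B : set V) : past m E ->
  P (E `&` U m @^-1` B) = P E * P (U m @^-1` B).
Proof.
move=> pE; have mE := past_measurable pE.
have mUB : measurable (U m @^-1` B) by exact: discrete_rv_preimage.
have hE v : (history m @^-1` [set v] `<=` E) \/
    E `&` history m @^-1` [set v] = set0.
  have [[w [Ew wv]]|h] := pselect (E `&` history m @^-1` [set v] !=set0).
    left=> w' w'v; rewrite (past_history pE); exists w => //.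
    by rewrite w'v wv.
  by right; apply: contrapT => h'; apply: h; exact/set0P/eqP.
rewrite (total_probability P (@measurable_history m)); last exact: measurableI.
rewrite (total_probability P (E := E) (@measurable_history m))// muleC
  -ge0_esumZl//.
apply: eq_esum => v _; rewrite muleC.
have [vE|v0] := hE v.
  by rewrite (setIC E) -setIA !(setIC E) !(setIidl vE) setIC history_indep.
by rewrite setIAC v0 set0I measure0 mul0e.
Qed.

(** The Markov property at time [m], by induction on [k], conditioning on the position [z] just
    before the last step. *)
Lemma walk_markov m E x k y : past m E ->
  P (E `&` [set w | S w m = x] `&` [set w | S w (m + k)%N = y]) =
  P (E `&` [set w | S w m = x]) * kernel_iter step_kernel k x y.
Proof.
move=> pE; have pF := pastI pE (@past_walk m x).
elim: k y => [|k IHk] y.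
  rewrite addn0 /=; have [->|xy] := eqVneq x y.
    by rewrite mule1 -setIA setIid.
  rewrite mule0 (_ : _ `&` _ = set0) ?measure0//.
  by apply/seteqP; split => // w [[_ /= ->]] /eqP; rewrite (negPf xy).
rewrite (total_probability P (@measurable_walk (m + k))); last first.
  by apply: measurableI; [exact: past_measurable pF|exact: measurable_walk].
rewrite [X in _ * X]/= -ge0_esumZl//; last first.
  by move=> z; rewrite mule_ge0// kernel_iter_ge0// => *; exact: measure_ge0.
apply: eq_esum => z _; rewrite muleA -IHk.
(* The last step has index [m + k]: it has the law of step 0 and is independent of all that happened
   before it. *)
rewrite /step_kernel -(identU (m + k)) -past_indep; last first.
  by apply: pastI; [apply: pastW pF; exact: leq_addr|exact: past_walk].
congr (P _); apply/seteqP; split => w /=; rewrite addnS /=.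
  by move=> [[? ?] <-].
by move=> [[? <-] ?].
Qed.

(** The event [E] is kept general so that the induction can absorb the position at time [m] into the
    past of time [m + k]. *)
Lemma walk_path m E x a v : past m E ->
  P (E `&` [set w | S w m = x] `&`
     [set w | [seq S w n | n <- scanl addn m a] = v]) =
  P (E `&` [set w | S w m = x]) * path_weight step_kernel a v x.
Proof.
elim: a m E x v => [|k a IHa] m E x [|y v] pE /=.
- rewrite mule1 (_ : [set _ | [::] = [::]] = setT) ?setIT//.
  by apply/seteqP; split.
- rewrite mule0 (_ : [set _ | [::] = _ :: _] = set0) ?setI0 ?measure0//.
  by apply/seteqP; split.
- rewrite mule0 (_ : [set _ | _ = [::]] = set0) ?setI0 ?measure0//.
  by apply/seteqP; split.
rewrite muleA -walk_markov// -IHa; last first.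
  by apply: (pastW (leq_addr k m)); apply: pastI => //; exact: past_walk.
congr (P _); apply/seteqP; split => w /=.
  by move=> [? [? ?]].
by move=> [[? ->] ->].
Qed.

Lemma walk_path_law a v :
  P [set w | [seq S w n | n <- scanl addn 0%N a] = v] =
  path_weight step_kernel a v x0.
Proof.
have := @walk_path 0 setT x0 a v; rewrite setTI.
have -> : [set w | S w 0 = x0] = setT by apply/seteqP; split.
by rewrite setTI probability_setT mul1e => ->.
Qed.

End iid_walk.

(** * Joint law of the increments of a Poisson process *)

Section poisson_increments.
Variable R : realType.
Implicit Types (t : {nonneg R}) (l : seq {nonneg R}).

Fixpoint increment_weight (lam : R) t0 l (a : seq nat) : \bar R :=
  match l, a with
  | [::], [::] => 1
  | t :: l', k :: a' => (poisson_weight (lam * (t%:num - t0%:num)) k)%:E *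
                        increment_weight lam t l' a'
  | _, _ => 0
  end.

Lemma increment_weight_ge0 lam t0 l a : (0 <= lam)%R ->
  path <=%R t0 l -> 0 <= increment_weight lam t0 l a.
Proof.
move=> lam0; elim: l t0 a => [|t l IHl] t0 [|k a] //= /andP[t0t tl].
rewrite mule_ge0 ?IHl// lee_fin poisson_weight_ge0// mulr_ge0// subr_ge0.
exact: t0t.
Qed.

(** The indexed product is the form in which mutual independence delivers the joint law. *)
Lemma increment_weightE lam t0 l a : size a = size l ->
  increment_weight lam t0 l a = \prod_(0 <= i < size l)
    (poisson_weight (lam * ((nth t0 l i)%:num - (nth t0 (t0 :: l) i)%:num))
                    (nth 0%N a i))%:E.
Proof.
elim: l t0 a => [|t l IHl] t0 [|k a] //=; first by rewrite big_nil.
move=> [sza]; rewrite big_nat_recl//= IHl//; congr (_ * _).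
apply: eq_big_nat => i /andP[_ il].
by rewrite [nth t l i](set_nth_default t0)// [nth t _ i](set_nth_default t0)//
  ltnW.
Qed.

Context d (T : measurableType d) (P : probability T R).
Variables (lam : R) (N : {nonneg R} -> {RV P >-> nat}).
Hypotheses (lam0 : (0 < lam)%R) (pN : poisson_process P lam N).

Lemma discrete_rv_process t : discrete_rv (N t : T -> nat).
Proof. by move=> k; rewrite -[X in measurable X]setTI;
  exact: measurable_funPT. Qed.

Lemma poisson_increment s t k : (s <= t)%R ->
  P [set w | (N t w - N s w)%N = k] =
  (poisson_weight (lam * (t%:num - s%:num)) k)%:E.
Proof.
case: pN => _ _ law; rewrite le_eqVlt => /predU1P[->|st].
  rewrite subrr mulr0 poisson_weight0; have [->|k0] := eqVneq k 0%N.
    by rewrite (_ : [set _ | _] = setT) ?probability_setT//; apply/seteqP;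
      split => // w _ /=; rewrite subnn.
  rewrite (_ : [set _ | _] = set0) ?measure0//; apply/seteqP; split => // w /=.
  by rewrite subnn => /eqP; rewrite eq_sym (negPf k0).
by rewrite law// poisson_weightE// mulr_gt0// subr_gt0.
Qed.

Lemma increment_law t0 l a : path <=%R t0 l ->
  P [set w | pairmap (fun s t => (N t w - N s w)%N) t0 l = a] =
  increment_weight lam t0 l a.
Proof.
move=> t0l; have [sza|sza] := eqVneq (size a) (size l); last first.
  rewrite (_ : [set _ | _] = set0) ?measure0; last first.
    apply/seteqP; split => // w /= wa; move/eqP : sza; apply.
    by rewrite -wa size_pairmap.
  by elim: l t0 a sza {t0l} => [|t l IHl] t0 [|k a] //= sza;
    rewrite -IHl ?mule0.
rewrite increment_weightE//.
(* Clamping the index at [size l] extends the finite list of times to an infinite nondecreasing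
   sequence, as [poisson_process] expects. Time [t0] has index 0, so increment [i] runs from [t i]
   to [t i.+1]. *)
pose t i := nth t0 (t0 :: l) (minn i (size l)).
have tE i : (i <= size l)%N -> t i = nth t0 (t0 :: l) i.
  by move=> il; rewrite /t (minn_idPl il).
have t_homo : {homo t : i j / (i <= j)%N >-> (i <= j)%R}.
  move=> i j ij; apply: (sorted_leq_nth le_trans le_refl) => //=.
  - by rewrite inE ltnS geq_minr.
  - by rewrite inE ltnS geq_minr.
  - by rewrite leq_min geq_minr andbT (leq_trans (geq_minl _ _)).
have -> : [set w | pairmap (fun s t => (N t w - N s w)%N) t0 l = a] =
    \bigcap_(i in [set` iota 0 (size l)])
      ((fun w => (N (t i.+1) w - N (t i) w)%N) @^-1` [set nth 0%N a i]).
  apply/seteqP; split => [w /= <- i|w /= h].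
    rewrite /= mem_iota /= add0n => il; rewrite !tE ?(ltnW il)//=.
    by rewrite (nth_pairmap t0).
  apply: (@eq_from_nth _ 0%N); rewrite size_pairmap// => i il.
  have := h i; rewrite /= mem_iota /= add0n => /(_ il) <-.
  by rewrite !tE ?(ltnW il)//= (nth_pairmap t0).
case: pN => _ ind _; rewrite ind ?iota_uniq//.
have -> : iota 0 (size l) = index_iota 0 (size l) by rewrite /index_iota subn0.
apply: eq_big_nat => i /andP[_ il].
rewrite -poisson_increment.
  by rewrite !tE ?(ltnW il).
by have := t_homo i i.+1 (leqnSn i); rewrite !tE ?(ltnW il).
Qed.

End poisson_increments.

(** * Transition weights with the numbers of steps summed out *)

Section mixture_weight.
Variables (R : realType) (V : countType).
Implicit Types (l : seq {nonneg R}) (K : V -> V -> \bar R).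

Fixpoint mixture_weight (lam : R) K (t0 : {nonneg R}) l (v : seq V) (x : V)
    : \bar R :=
  match l, v with
  | [::], [::] => 1
  | t :: l', y :: v' => poisson_mixture K (lam * (t%:num - t0%:num)) x y *
                        mixture_weight lam K t l' v' y
  | _, _ => 0
  end.

(** Splitting off the first increment and the first state factors each term: the sum over the
    remaining increments is the induction hypothesis, and the sum over the first one is
    [poisson_mixture]. *)
Lemma esum_increment_path lam K t0 l v x : (0 <= lam)%R -> path <=%R t0 l ->
  (forall x y, 0 <= K x y) ->
  \esum_(a in setT) (increment_weight lam t0 l a * path_weight K a v x) =
  mixture_weight lam K t0 l v x.
Proof.
move=> lam0 t0l K0; elim: l t0 v x t0l => [|t l IHl] t0 v x t0l.
  rewrite (@esum_single _ _ [::]) /=.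
  - by case: v => [|y v]; rewrite ?mul1e ?mule0.
  - by case=> // k a _; rewrite mul0e.
  - by case: v => [|y v]; rewrite ?mul1e ?mule0.
have /= /andP[t0t tl] := t0l.
have ipos a v' : 0 <= increment_weight lam t0 (t :: l) a * path_weight K a v' x.
  by rewrite mule_ge0 ?path_weight_ge0 ?increment_weight_ge0.
rewrite esum_seq; last by move=> a; exact: ipos.
rewrite [X in X + _]mul0e add0e; case: v => [|y v].
  by rewrite esum1// => k _; rewrite esum1// => a _; rewrite mule0.
have L0 : (0 <= lam * (t%:num - t0%:num))%R by rewrite mulr_ge0// subr_ge0.
have w0 a : 0 <= (poisson_weight (lam * (t%:num - t0%:num)) a)%:E.
  by rewrite lee_fin poisson_weight_ge0.
have ki0 k : 0 <= kernel_iter K k x y by exact: kernel_iter_ge0.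
rewrite -IHl// muleC -ge0_esumZl; last 2 first.
- by apply: esum_ge0 => a _;
  rewrite mule_ge0 ?path_weight_ge0 ?increment_weight_ge0.
- by move=> k; rewrite mule_ge0.
apply: eq_esum => k _; rewrite muleC -ge0_esumZl; last 2 first.
- by rewrite mule_ge0.
- by move=> a; rewrite mule_ge0 ?path_weight_ge0 ?increment_weight_ge0.
by apply: eq_esum => a _; rewrite muleACA.
Qed.

Lemma mixture_weight_lazy K K' lam p t0 l v x : (0 <= lam)%R ->
  (0 <= p <= 1)%R -> path <=%R t0 l -> (forall x y, 0 <= K x y) ->
  (forall x y, K' x y = p%:E * (x == y)%:R%:E + (1 - p)%:E * K x y) ->
  mixture_weight lam K' t0 l v x = mixture_weight (lam * (1 - p)) K t0 l v x.
Proof.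
move=> lam0 p01 + K0 K'E.
elim: l t0 v x => [|t l IHl] t0 [|y v] x //= /andP[t0t tl].
rewrite IHl// (poisson_mixture_lazy _ _ _ p01 K0 K'E) ?mulr_ge0 ?subr_ge0//.
by rewrite mulrAC.
Qed.

End mixture_weight.

(* Measurability for this coarser sigma-algebra on [T] is by conversion
   membership in [sigma_of_family X]. *)
Lemma discrete_rv_sigma_of_family d d' (T : measurableType d)
    (T' : measurableType d') (I : Type) (X : I -> T -> T') (i : I) :
  (forall c : T', measurable [set c]) ->
  discrete_rv (X i : g_sigma_algebraType
    (\bigcup_i preimage_set_system setT (X i) measurable) -> T').
Proof.
move=> m1 c; apply: sub_sigma_algebra; exists i => //.
by exists [set c] => //; rewrite setTI.
Qed.

(** * Comparing probabilities, and recovering values from increments *)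

(** Removing the null set [Z] changes neither probability and makes the two events equal. *)
Lemma ae_eq_probability d (T : measurableType d) (R : realType)
    (P : probability T R) (A B : set T) : measurable A -> measurable B ->
  {ae P, forall w, A w <-> B w} -> P A = P B.
Proof.
move=> mA mB [Z [mZ PZ0 hZ]].
have AZ (C : set T) : measurable C -> P C = P (C `\` Z).
  move=> mC; rewrite measureD//; last by rewrite ltey_eq fin_num_measure.
  rewrite [X in _ - X](_ : _ = 0) ?sube0//; apply/eqP.
  by rewrite -measure_le0 -PZ0 le_measure ?inE//; exact: measurableI.
rewrite AZ// [RHS]AZ//; congr (P _); apply/seteqP.
by split => w [wA nZ]; split => //; apply: contrapT => nw; apply: nZ;
  apply: hZ => /= h; apply: nw; apply/h.
Qed.

Lemma eq_law_preimage (R : realType) d1 d2 (T1 : measurableType d1)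
    (T2 : measurableType d2) (P1 : probability T1 R) (P2 : probability T2 R)
    (C : countType) (X : T1 -> C) (Y : T2 -> C) (B : set C) :
  discrete_rv X -> discrete_rv Y ->
  (forall c, P1 (X @^-1` [set c]) = P2 (Y @^-1` [set c])) ->
  P1 (X @^-1` B) = P2 (Y @^-1` B).
Proof.
move=> mX mY XY.
rewrite (total_probability P1 mX); last exact: discrete_rv_preimage.
rewrite (total_probability P2 mY); last exact: discrete_rv_preimage.
apply: eq_esum => c _; rewrite -!preimage_setI.
have [Bc|nBc] := pselect (B c).
  by rewrite (_ : B `&` [set c] = [set c]) ?XY//; apply/seteqP;
    split => [x []|x /= ->].
rewrite (_ : B `&` [set c] = set0) ?preimage_set0 ?measure0//.
by apply/seteqP; split => // x [Bx /= xc]; apply: nBc; rewrite -xc.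
Qed.

(** Telescoping; monotonicity along the path makes the truncated subtractions exact. *)
Lemma scanl_pairmap_sub (I : Type) (n : I -> nat) (e : rel I) t0 (l : seq I) :
  (forall s t, e s t -> (n s <= n t)%N) -> path e t0 l ->
  scanl addn (n t0) (pairmap (fun s t => (n t - n s)%N) t0 l) = map n l.
Proof.
move=> ne; elim: l t0 => //= t l IHl t0 /andP[et tl].
by rewrite subnKC ?ne// IHl.
Qed.

(** * Vectors of natural numbers as the state space *)

Section tuple_nat.
Variable d : nat.

Definition tuple_add (x y : d.-tuple nat) : d.-tuple nat :=
  [tuple (tnth x i + tnth y i)%N | i < d].

Lemma tuple_add0 x : tuple_add x [tuple 0%N | _ < d] = x.
Proof. by apply: eq_from_tnth => i; rewrite !tnth_mktuple addn0. Qed.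

Lemma walk_tuple_add (u : nat -> d.-tuple nat) m :
  walk tuple_add [tuple 0%N | _ < d] u m =
  [tuple (\sum_(i < m) tnth (u i) s)%N | s < d].
Proof.
elim: m => [|m IHm] /=; apply: eq_from_tnth => s; rewrite !tnth_mktuple.
  by rewrite big_ord0.
by rewrite IHm tnth_mktuple big_ord_recr.
Qed.

(** Listing the coordinates is an injective discrete random variable on tuples, so every set of
    tuples is the preimage of its image. *)
Lemma measurable_tuple_nat (B : set (d.-tuple nat)) : measurable B.
Proof.
pose f (x : d.-tuple nat) := [seq tnth x i | i <- enum 'I_d].
have mf : discrete_rv f.
  apply: discrete_rv_map => i k; rewrite -[X in measurable X]setTI.
  exact: measurable_tnth.
rewrite (_ : B = f @^-1` (f @` B)); first exact: discrete_rv_preimage.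
apply/seteqP; split => [x Bx|x [y By yx]]; first by exists x.
suff <- : y = x by [].
apply: eq_from_tnth => i; move/eq_in_map : yx; apply.
by rewrite mem_enum.
Qed.

Lemma discrete_rv_tuple d' (T : measurableType d') (R : realType)
    (P : probability T R) (X : {RV P >-> d.-tuple nat}) :
  discrete_rv (X : T -> d.-tuple nat).
Proof.
move=> c; rewrite -[X in measurable X]setTI.
by apply: measurable_funPT => //; exact: measurable_tuple_nat.
Qed.

End tuple_nat.

(** * Law of the compound process at sorted times *)

Section compound.
Context (R : realType) (d : nat) disp (T : measurableType disp).
Context (P : probability T R) (lam : R).
Variables (N : {nonneg R} -> {RV P >-> nat}).
Variables (U : nat -> {RV P >-> d.-tuple nat}).
Hypotheses (lam0 : (0 < lam)%R) (pN : poisson_process P lam N).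
Hypotheses (iidU : iid P U) (NU : independent_families P N U).

Let V := d.-tuple nat.
Let t0 : {nonneg R} := (0%:nng)%R.
Let v0 : V := [tuple 0%N | _ < d].
Let K := step_kernel P (@tuple_add d) (fun i => U i : T -> V).
Let S w m := walk (@tuple_add d) v0 (U ^~ w) m.

(** The indicator is absorbed because the empty sum is already 0. *)
Lemma compoundE t w : compound N U t w = S w (N t w).
Proof.
rewrite /S walk_tuple_add; apply: eq_from_tnth => s; rewrite !tnth_mktuple.
by case: (N t w) => [|n]; rewrite ?big_ord0// mul1n.
Qed.

Lemma discrete_rv_compound t : discrete_rv (compound N U t).
Proof.
rewrite (_ : compound N U t = fun w => S w (N t w)); last first.
  by apply/funext => w; rewrite compoundE.
apply: (discrete_rv_dep (Y := fun m w => S w m)).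
  exact: discrete_rv_process.
by move=> m; apply: measurable_walk => i; exact: discrete_rv_tuple.
Qed.

(* Almost surely [N] at the times of [l] is recovered from its increments by
   partial summation; one then conditions on the vector of increments, which is
   independent of [U]. *)
Lemma compound_law l v : path <=%R t0 l ->
  P [set w | [seq compound N U t w | t <- l] = v] =
  mixture_weight lam K t0 l v v0.
Proof.
move=> l0; pose D w := pairmap (fun s t => (N t w - N s w)%N) t0 l.
have mN t : discrete_rv (N t : T -> nat) by exact: discrete_rv_process.
have mU i : discrete_rv (U i : T -> V) by exact: discrete_rv_tuple.
have mS m : discrete_rv (fun w => S w m) by exact: measurable_walk.
have mD : discrete_rv D.
  apply: (discrete_rv_pairmap (X := fun s t w => (N t w - N s w)%N)) => s t.
  exact: discrete_rv_comp2.
have mSs a : discrete_rv (fun w => [seq S w n | n <- scanl addn 0%N a]).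
  exact: discrete_rv_map.
rewrite (@ae_eq_probability _ _ _ _ _
    [set w | [seq S w n | n <- scanl addn 0%N (D w)] = v]); last 3 first.
- by apply: (@discrete_rv_map _ _ _ _ (compound N U) l);
  exact: discrete_rv_compound.
- by apply: (discrete_rv_dep (Y := fun a w => [seq S w n | n <- scanl addn 0%N
  a])).
- case: pN => + _ _; apply: filterS => w [N0 Nmono _].
  have Nt0 : N t0 w = 0%N by exact: N0.
  have := @scanl_pairmap_sub _ (fun t => N t w) <=%R t0 l Nmono l0.
  rewrite Nt0 /= -/(D w) => ->; rewrite -map_comp.
  by rewrite (eq_map (fun t => compoundE t w)).
rewrite (total_probability P mD); last first.
  by apply: (discrete_rv_dep (Y := fun a w => [seq S w n | n <- scanl addn 0%N
    a])).
rewrite -(@esum_increment_path _ _ lam K t0 l v v0 (ltW lam0) l0); last first.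
  by move=> x y; exact: measure_ge0.
apply: eq_esum => a _; rewrite -(increment_law lam0 pN)// -walk_path_law//;
  last 2 first.
- move=> J B uJ; case: iidU => + _; apply=> // i; exact: measurable_tuple_nat.
- move=> i B; case: iidU => _; apply; exact: measurable_tuple_nat.
(* The two factors are events of [N] alone and of [U] alone. Reading the measurability lemmas with
   the generated sigma-algebra on [T] gives the memberships that independence of the families
   requires. *)
rewrite -(NU (A := D @^-1` [set a])); last 2 first.
- apply: (discrete_rv_pairmap (T := g_sigma_algebraType
    (\bigcup_t preimage_set_system setT (N t) measurable))
    (X := fun s t w => (N t w - N s w)%N)) => s t.
  by apply: discrete_rv_comp2; exact: discrete_rv_sigma_of_family.
- apply: (discrete_rv_map (T := g_sigma_algebraType
    (\bigcup_i preimage_set_system setT (U i) measurable))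
    (X := fun m w => S w m)) => m.
  apply: measurable_walk => i; apply: discrete_rv_sigma_of_family => c.
  exact: measurable_tuple_nat.
congr (P _); apply/seteqP; split => w /=.
  by move=> [+ Da]; rewrite Da.
by move=> [Da]; rewrite /= -Da.
Qed.

End compound.

Local Close Scope ereal_scope.

(** * From sorted times to arbitrary times *)

Section sorted_times.
Variables (R : realType) (d1 d2 : measure_display).
Variables (T1 : measurableType d1) (T2 : measurableType d2).
Variables (P1 : probability T1 R) (P2 : probability T2 R).
Variables (V : countType) (v0 : V).
Variables (X : {nonneg R} -> T1 -> V) (Y : {nonneg R} -> T2 -> V).
Hypotheses (mX : forall t, discrete_rv (X t)) (mY : forall t, discrete_rv (Y
  t)).

(* An arbitrary family of times is read off a sorted list of times by indexing,
   and on a countable state space laws are determined by atoms. *)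
Lemma eq_fdd_sorted :
  (forall l v, path <=%R (0%:nng : {nonneg R}) l ->
    P1 [set w | [seq X t w | t <- l] = v] =
    P2 [set w | [seq Y t w | t <- l] = v]) ->
  forall n (t : 'I_n -> {nonneg R}) (B : set (n.-tuple V)),
    P1 [set w | B [tuple X (t j) w | j < n]] =
    P2 [set w | B [tuple Y (t j) w | j < n]].
Proof.
move=> XY n t B; pose l := sort <=%R (codom t).
have tl j : t j \in l by rewrite mem_sort codom_f.
have l0 : path <=%R (0%:nng : {nonneg R}) l.
  rewrite path_sortedE; last exact: le_trans.
  rewrite sort_sorted ?andbT; last exact: le_total.
  by apply/allP => s _; rewrite -num_le /=.
(* [f] undoes the sorting: coordinate [j] is looked up at the position of [t j] in [l]. The default
   [v0] is not reached on lists as long as [l]. *)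
pose f v := [tuple nth v0 v (index (t j) l) | j < n].
have fE (Z : {nonneg R} -> V) :
    [tuple Z (t j) | j < n] = f [seq Z s | s <- l].
  apply: eq_from_tnth => j; rewrite !tnth_mktuple.
  by rewrite (nth_map 0%:nng) ?index_mem// nth_index.
rewrite (_ : [set w | _] = (fun w => [seq X s w | s <- l]) @^-1` (B \o f)).
  rewrite [in RHS](_ : [set w | _] =
    (fun w => [seq Y s w | s <- l]) @^-1` (B \o f)).
    apply: eq_law_preimage => [||v]; try exact: discrete_rv_map.
    exact: XY.
  by apply/funext => w /=; rewrite (fE (Y ^~ w)).
by apply/funext => w /=; rewrite (fE (X ^~ w)).
Qed.

End sorted_times.

(** * The lazy kernel of possibly empty groups, and the conclusion *)

(** The step is split according to whether the group is empty: an empty group, of probability [p0],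
    leaves [x] fixed, and a non-empty one follows the conditional law, which is that of [U]. *)
Lemma step_kernel_cond (R : realType) (d : nat)
    (disp1 disp2 : measure_display)
    (T1 : measurableType disp1) (T2 : measurableType disp2)
    (P1 : probability T1 R) (P2 : probability T2 R) (p0 : R)
    (Ut : nat -> {RV P1 >-> d.-tuple nat})
    (U : nat -> {RV P2 >-> d.-tuple nat}) :
  P1 [set w | Ut 0%N w = [tuple 0%N | _ < d]] = p0%:E -> p0 < 1 ->
  (forall B : set (d.-tuple nat), measurable B ->
      distribution P2 (U 0%N) B =
      (cond_prob P1 (Ut 0%N @^-1` B)
                 [set w | Ut 0%N w <> [tuple 0%N | _ < d]])%:E) ->
  forall x y,
  (step_kernel P1 (@tuple_add d) (fun i => Ut i : T1 -> d.-tuple nat) x y =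
   p0%:E * (x == y)%:R%:E + (1 - p0)%:E *
   step_kernel P2 (@tuple_add d) (fun i => U i : T2 -> d.-tuple nat) x y)%E.
Proof.
move=> hp0 p01 hU x y.
pose A := [set u | tuple_add x u = y].
pose Z := [set w | Ut 0%N w = [tuple 0%N | _ < d]].
have mUt B : measurable (Ut 0%N @^-1` B).
  by apply: discrete_rv_preimage; exact: discrete_rv_tuple.
have mZ : measurable Z by exact: (mUt [set [tuple 0%N | _ < d]]).
have ZC : [set w | Ut 0%N w <> [tuple 0%N | _ < d]] = ~` Z by [].
have PZC : P1 (~` Z) = (1 - p0)%:E by rewrite probability_setC// hp0.
rewrite /step_kernel -/A.
have -> : P2 (U 0%N @^-1` A) =
    (cond_prob P1 (Ut 0%N @^-1` A) (~` Z))%:E.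
  by rewrite -ZC -hU//; exact: measurable_tuple_nat.
(* The factor [1 - p0] cancels the denominator of the conditional probability, which is nonzero
   because [p0 < 1]. *)
rewrite /cond_prob PZC /= -(EFinM (1 - p0)) mulrCA divff ?mulr1; last first.
  by rewrite gt_eqF// subr_gt0.
rewrite fineK; last by rewrite fin_num_measure//; apply: measurableI => //;
  exact: measurableC.
rewrite (measureDI P1 (mUt A) mZ) addeC setDE; congr (_ + _)%E.
have [xy|xy] := eqVneq x y; rewrite ?mule1 ?mule0.
  by rewrite setIC setIidl// => w /= ->; rewrite /A /= tuple_add0.
rewrite (_ : _ `&` _ = set0) ?measure0//; apply/seteqP;
  split => // w [/= wA wZ].
by move: wA; rewrite /A /= wZ tuple_add0 => /eqP; rewrite (negPf xy).
Qed.

Theorem lemma4p2 (R : realType) (d : nat)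
    (disp1 disp2 : measure_display)
    (T1 : measurableType disp1) (T2 : measurableType disp2)
    (P1 : probability T1 R) (P2 : probability T2 R)
    (lambdat p0 : R)
    (Nt : {nonneg R} -> {RV P1 >-> nat})
    (Ut : nat -> {RV P1 >-> d.-tuple nat})
    (N : {nonneg R} -> {RV P2 >-> nat})
    (U : nat -> {RV P2 >-> d.-tuple nat})
    (hlambda : 0 < lambdat)
    (hNt : poisson_process P1 lambdat Nt)
    (hUt : iid P1 Ut)
    (hNUt : independent_families P1 Nt Ut)
    (hp0 : P1 [set w | Ut 0%N w = [tuple 0%N | _ < d]] = p0%:E)
    (hp01 : 0 <= p0 < 1)
    (hU : iid P2 U)
    (hUcond : forall (i : nat) (B : set (d.-tuple nat)), measurable B ->
      distribution P2 (U i) B =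
      (cond_prob P1 (Ut 0%N @^-1` B)
                 [set w | Ut 0%N w <> [tuple 0%N | _ < d]])%:E)
    (hN : poisson_process P2 (lambdat * (1 - p0)) N)
    (hNU : independent_families P2 N U) :
  same_fdd P1 P2 (compound Nt Ut) (compound N U).
Proof.
have /andP[p0_ge0 p0_lt1] := hp01.
move=> n t B _.
apply: (eq_fdd_sorted [tuple 0%N | _ < d]) => [s|s|l v l0].
- exact: discrete_rv_compound.
- exact: discrete_rv_compound.
rewrite (compound_law hlambda hNt hUt hNUt v l0).
rewrite (compound_law _ hN hU hNU v l0); last first.
  by rewrite mulr_gt0// subr_gt0.
(* Both laws are now mixture weights started at the zero vector, with rates differing by the factor
   [1 - p0]; what remains is that one kernel is the lazy version of the other. *)
apply: mixture_weight_lazy => //.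
- exact: ltW.
- by rewrite p0_ge0 ltW.
- exact: (step_kernel_cond hp0 p0_lt1 (hUcond 0%N)).
Qed.
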